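(* Let $0<\delta<\frac{\pi}{2}$. A convex body $D\subset S^2$ is of constant diameter $\delta$ if and only if it is of constant width $\delta$.
   Context: $S^2$ is the unit sphere in $E^{3}$; $|ab|$ denotes spherical distance (length of the shorter great-circle arc $ab$). A set containing no pair of antipodes is convex if it contains the arc joining any two of its points; a closed convex set with non-empty interior is a convex body. A hemisphere is the intersection of $S^2$ with a closed half-space of $E^{3}$ bounded by a plane through the origin. A hemisphere $H$ supports a convex body $C$ at $p$ if $C\subset H$ and $p\in\mathrm{bd}(H)\cap C$. For different, non-opposite hemispheres $G,H$, the lune $G\cap H$ has thickness equal to the spherical distance between the midpoints of the semicircles $\mathrm{bd}(G)\cap H$ and $\mathrm{bd}(H)\cap G$. For a hemisphere $K$ supporting $C$, $\mathrm{width}_K(C)$ is the thickness of a narrowest lune of the form $K\cap K^*$ containing $C$; $C$ is of constant width $w$ if $\mathrm{width}_K(C)=w$ for every supporting hemisphere $K$ of $C$. A convex body $D$ of diameter $\delta$ is of constant diameter $\delta$ if for every $p\in\mathrm{bd}(D)$ there is $p'\in\mathrm{bd}(D)$ with $|pp'|=\delta$. *)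

(* Defs.v *)
From Stdlib Require Import Reals Lra.
Open Scope R_scope.

Record vec := V { vx : R; vy : R; vz : R }.

Definition dot (a b : vec) : R := vx a * vx b + vy a * vy b + vz a * vz b.
Definition vadd (a b : vec) : vec := V (vx a + vx b) (vy a + vy b) (vz a + vz b).
Definition vscale (t : R) (a : vec) : vec := V (t * vx a) (t * vy a) (t * vz a).
Definition vopp (a : vec) : vec := vscale (-1) a.
Definition vnorm (a : vec) : R := sqrt (dot a a).
Definition edist (a b : vec) : R := vnorm (vadd a (vopp b)).

Definition on_S2 (x : vec) : Prop := dot x x = 1.

Definition sdist (a b : vec) : R := acos (dot a b).

Definition antipodal (a b : vec) : Prop := b = vopp a.

(* The (shorter) great-circle arc joining two non-antipodal points a b of S^2 *)
Definition on_arc (a b x : vec) : Prop :=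
  exists t, 0 <= t <= 1 /\
    x = vscale (/ vnorm (vadd (vscale (1 - t) a) (vscale t b)))
               (vadd (vscale (1 - t) a) (vscale t b)).

Definition convex (C : vec -> Prop) : Prop :=
  (forall x, C x -> on_S2 x) /\
  (forall a b, C a -> C b -> ~ antipodal a b) /\
  (forall a b x, C a -> C b -> on_arc a b x -> C x).

Definition closed_S2 (C : vec -> Prop) : Prop :=
  forall x, on_S2 x -> ~ C x ->
    exists eps, 0 < eps /\ forall y, on_S2 y -> edist x y < eps -> ~ C y.

Definition interior_pt (C : vec -> Prop) (p : vec) : Prop :=
  exists eps, 0 < eps /\ forall y, on_S2 y -> edist p y < eps -> C y.

Definition boundary_pt (C : vec -> Prop) (p : vec) : Prop :=
  on_S2 p /\ C p /\
  forall eps, 0 < eps -> exists y, on_S2 y /\ edist p y < eps /\ ~ C y.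

Definition convex_body (C : vec -> Prop) : Prop :=
  convex C /\ closed_S2 C /\ exists p, C p /\ interior_pt C p.

Definition hemi (n : vec) (x : vec) : Prop := on_S2 x /\ 0 <= dot x n.
Definition hemi_bd (n : vec) (x : vec) : Prop := on_S2 x /\ dot x n = 0.
Definition is_hemi (n : vec) : Prop := on_S2 n.

Definition subset (A B : vec -> Prop) : Prop := forall x, A x -> B x.

Definition supports_at (k : vec) (C : vec -> Prop) (p : vec) : Prop :=
  is_hemi k /\ subset C (hemi k) /\ hemi_bd k p /\ C p.
Definition supporting (k : vec) (C : vec -> Prop) : Prop :=
  exists p, supports_at k C p.

Definition lune_pair (g h : vec) : Prop :=
  is_hemi g /\ is_hemi h /\ g <> h /\ h <> vopp g.

(* c is the midpoint of the semicircle bd(G) ∩ H: a point of that semicircle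
   equidistant from its two endpoints, which are the two points of bd(G) ∩ bd(H). *)
Definition semicircle_midpoint (g h c : vec) : Prop :=
  hemi_bd g c /\ hemi h c /\
  forall e1 e2, hemi_bd g e1 -> hemi_bd h e1 -> hemi_bd g e2 -> hemi_bd h e2 ->
    e1 <> e2 -> sdist c e1 = sdist c e2.

Definition lune_thickness (g h : vec) (w : R) : Prop :=
  lune_pair g h /\
  exists c1 c2, semicircle_midpoint g h c1 /\ semicircle_midpoint h g c2 /\
    w = sdist c1 c2.

Definition lune (g h : vec) (x : vec) : Prop := hemi g x /\ hemi h x.

Definition width_is (k : vec) (C : vec -> Prop) (w : R) : Prop :=
  (exists ks, lune_thickness k ks w /\ subset C (lune k ks)) /\
  (forall ks w', lune_thickness k ks w' -> subset C (lune k ks) -> w <= w').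

Definition constant_width (C : vec -> Prop) (w : R) : Prop :=
  forall k, supporting k C -> width_is k C w.

Definition diameter_is (D : vec -> Prop) (d : R) : Prop :=
  is_lub (fun r => exists x y, D x /\ D y /\ r = sdist x y) d.

Definition constant_diameter (D : vec -> Prop) (d : R) : Prop :=
  convex_body D /\ diameter_is D d /\
  forall p, boundary_pt D p -> exists p', boundary_pt D p' /\ sdist p p' = d.

(* Main.v *)
(** Write [c = cos delta]. A lune [k], [h] has thickness [acos (- dot k h)], so constant width
    [delta] says that on the polar [E] of [D] (the set of hemispheres containing [D]) each
    supporting [k] satisfies [min over h in E of dot k h = - c].

    If [D] has constant diameter, it is complete: a point [z] outside [D] within [delta] of all
    of [D] would put some boundary point [p] strictly between [z] and an interior point of [D],
    and the partner of [p] would then be farther than [delta] from one of the two. If [k]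
    supports [D] at [p], completeness forces the point [p'] at distance [delta] from [p] along
    [k] into [D], and the hemisphere orthogonal to the arc [p p'] at [p'] attains the minimum.

    Conversely, the first-order condition for a minimizer [h] of [dot k h] on [E] and the bipolar
    theorem put the midpoints of both semicircles of the lune [k], [h] into [D]; these lie at
    distance [delta], and the diameter bound forces the support point [p] of [k] to be one of
    them. The diameter bound itself holds because [D] is supported, at the point [y] of [D]
    farthest from [x], by the hemisphere orthogonal to the arc [x y]. *)
Require Import Defs.
From Stdlib Require Import Reals Lra Psatz Classical.
Open Scope R_scope.

(** * Vectors, norms and chordal distance *)

Lemma dot_comm (a b : vec) : dot a b = dot b a.
Proof. unfold dot; ring. Qed.

Lemma dot_vadd_l (a b x : vec) : dot (vadd a b) x = dot a x + dot b x.
Proof. unfold dot; simpl; ring. Qed.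

Lemma dot_vadd_r (a b x : vec) : dot x (vadd a b) = dot x a + dot x b.
Proof. unfold dot; simpl; ring. Qed.

Lemma dot_vscale_l (t : R) (a x : vec) : dot (vscale t a) x = t * dot a x.
Proof. unfold dot; simpl; ring. Qed.

Lemma dot_vscale_r (t : R) (a x : vec) : dot x (vscale t a) = t * dot x a.
Proof. unfold dot; simpl; ring. Qed.

Ltac dots := unfold vopp in *;
  repeat first [rewrite dot_vadd_l in * | rewrite dot_vadd_r in *
               | rewrite dot_vscale_l in * | rewrite dot_vscale_r in *].

Lemma vec_eq (a b : vec) : vx a = vx b -> vy a = vy b -> vz a = vz b -> a = b.
Proof. destruct a, b; simpl; intros; subst; reflexivity. Qed.

Lemma dot_self_ge0 (a : vec) : 0 <= dot a a.
Proof. unfold dot; nra. Qed.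

Lemma dot_self_eq0 (a : vec) : dot a a = 0 -> a = V 0 0 0.
Proof. unfold dot; intros H; apply vec_eq; simpl; nra. Qed.

Lemma vnorm_ge0 (a : vec) : 0 <= vnorm a.
Proof. apply sqrt_pos. Qed.

Lemma vnorm_sqr (a : vec) : vnorm a * vnorm a = dot a a.
Proof. apply sqrt_sqrt, dot_self_ge0. Qed.

Lemma vnorm_gt0 (a : vec) : 0 < dot a a -> 0 < vnorm a.
Proof. apply sqrt_lt_R0. Qed.

Lemma vnorm_S2 (a : vec) : on_S2 a -> vnorm a = 1.
Proof. intros H; unfold vnorm; rewrite H; apply sqrt_1. Qed.

Lemma dot_sqr_le (a b : vec) : dot a b * dot a b <= dot a a * dot b b.
Proof.
  assert (0 <= dot a a * dot b b - dot a b * dot a b); [|lra].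
  replace (dot a a * dot b b - dot a b * dot a b) with
    (Rsqr (vx a * vy b - vy a * vx b) + Rsqr (vx a * vz b - vz a * vx b)
     + Rsqr (vy a * vz b - vz a * vy b)) by (unfold dot, Rsqr; ring).
  repeat apply Rplus_le_le_0_compat; apply Rle_0_sqr.
Qed.

Lemma dot_le (a b : vec) : - (vnorm a * vnorm b) <= dot a b <= vnorm a * vnorm b.
Proof.
  pose proof (dot_sqr_le a b) as H.
  rewrite <- (vnorm_sqr a), <- (vnorm_sqr b) in H.
  pose proof (Rmult_le_pos _ _ (vnorm_ge0 a) (vnorm_ge0 b)).
  split; nra.
Qed.

Lemma dot_S2_le (a b : vec) : on_S2 a -> on_S2 b -> -1 <= dot a b <= 1.
Proof.
  intros Ha Hb; pose proof (dot_le a b).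
  rewrite (vnorm_S2 a Ha), (vnorm_S2 b Hb) in *; lra.
Qed.

Lemma dot_S2_eq1 (a b : vec) : on_S2 a -> on_S2 b -> dot a b = 1 -> a = b.
Proof.
  intros Ha Hb H; unfold on_S2 in *.
  assert (E : dot (vadd a (vopp b)) (vadd a (vopp b)) = 0).
  { dots; rewrite (dot_comm b a); lra. }
  apply dot_self_eq0 in E; injection E; intros; apply vec_eq; simpl in *; lra.
Qed.

Lemma dot_S2_eqN1 (a b : vec) : on_S2 a -> on_S2 b -> dot a b = -1 -> b = vopp a.
Proof.
  intros Ha Hb H; apply dot_S2_eq1; unfold on_S2 in *; dots; auto;
    rewrite ?(dot_comm b a); lra.
Qed.

Lemma bessel2 (p k x : vec) : on_S2 p -> on_S2 k -> dot p k = 0 -> on_S2 x ->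
  dot x p * dot x p + dot x k * dot x k <= 1.
Proof.
  intros Hp Hk Hpk Hx; unfold on_S2 in *.
  (* [m] is the determinant of [x], [p], [k], and [E] expands its square as a Gram determinant; for
     orthonormal [p], [k] this leaves [1] minus the two squared coordinates of [x]. *)
  set (m := vx x * (vy p * vz k - vz p * vy k) + vy x * (vz p * vx k - vx p * vz k)
            + vz x * (vx p * vy k - vy p * vx k)).
  assert (E : m * m = dot x x * (dot p p * dot k k - dot p k * dot p k)
     - dot x p * (dot x p * dot k k - dot p k * dot x k)
     + dot x k * (dot x p * dot p k - dot p p * dot x k)) by (unfold m, dot; ring).
  rewrite Hp, Hk, Hpk, Hx in E; nra.
Qed.

Lemma edist_ge0 (a b : vec) : 0 <= edist a b.
Proof. apply vnorm_ge0. Qed.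

Lemma edist_sqr (a b : vec) :
  edist a b * edist a b = dot a a - 2 * dot a b + dot b b.
Proof.
  unfold edist; rewrite vnorm_sqr; dots; rewrite (dot_comm b a); ring.
Qed.

Lemma dot_edist_le (x y a : vec) : on_S2 a -> dot x a <= dot y a + edist x y.
Proof.
  intros Ha; pose proof (dot_le (vadd x (vopp y)) a) as H.
  rewrite (vnorm_S2 a Ha) in H; dots; unfold edist, vopp; lra.
Qed.

(** * Radial projection onto the sphere *)

Definition unit (w : vec) : vec := vscale (/ vnorm w) w.

Lemma unit_S2 (w : vec) : 0 < dot w w -> on_S2 (unit w).
Proof.
  intros H; pose proof (vnorm_gt0 w H); unfold on_S2, unit; dots.
  rewrite <- vnorm_sqr; field; lra.
Qed.

Lemma dot_unit (w a : vec) : 0 < dot w w -> vnorm w * dot (unit w) a = dot w a.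
Proof.
  intros H; pose proof (vnorm_gt0 w H); unfold unit; dots; field; lra.
Qed.

Lemma unit_id (w : vec) : on_S2 w -> unit w = w.
Proof.
  intros H; unfold unit; rewrite (vnorm_S2 w H).
  apply vec_eq; simpl; field.
Qed.

Lemma unit_vscale (r : R) (w : vec) : 0 < r -> 0 < dot w w -> unit (vscale r w) = unit w.
Proof.
  intros Hr Hw; pose proof (vnorm_gt0 w Hw).
  assert (E : vnorm (vscale r w) = r * vnorm w).
  { apply sqrt_lem_1; [apply dot_self_ge0 | nra |].
    dots; rewrite <- vnorm_sqr; ring. }
  unfold unit; rewrite E; apply vec_eq; simpl; field; lra.
Qed.

(** As [unit w] is the point of the sphere nearest to [w], the triangle inequality through [w] gives
    the factor 2. The proof instead writes the difference of the squares as a sum of two nonnegative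
    products. *)
Lemma edist_unit (p w : vec) : on_S2 p -> 0 < dot w w ->
  edist p (unit w) <= 2 * edist p w.
Proof.
  intros Hp Hw.
  pose proof (vnorm_gt0 w Hw) as Hr.
  pose proof (unit_S2 w Hw) as Hu.
  pose proof (edist_sqr p (unit w)) as E1; pose proof (edist_sqr p w) as E2.
  pose proof (edist_ge0 p (unit w)); pose proof (edist_ge0 p w).
  pose proof (dot_S2_le p (unit w) Hp Hu) as Hb.
  rewrite (dot_comm p w), <- (dot_unit w p Hw), (dot_comm (unit w) p), <- (vnorm_sqr w) in E2.
  unfold on_S2 in *; rewrite Hp, Hu in *.
  set (u := dot p (unit w)) in *; set (r := vnorm w) in *.
  assert (edist p (unit w) * edist p (unit w) <= 4 * (edist p w * edist p w)).
  { rewrite E1, E2.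
    replace (4 * (1 - 2 * (r * u) + r * r)) with
      (1 - 2 * u + 1 + ((1 + u) * (2 * ((1 - r) * (1 - r))) + (1 - u) * (4 * r + 2 * (r * r)))).
    2: ring.
    assert (0 <= (1 + u) * (2 * ((1 - r) * (1 - r)))).
    { pose proof (Rle_0_sqr (1 - r)); unfold Rsqr in *; apply Rmult_le_pos; lra. }
    assert (0 <= (1 - u) * (4 * r + 2 * (r * r))) by (apply Rmult_le_pos; nra).
    lra. }
  nra.
Qed.

Lemma edist_shift (p v : vec) (t : R) : edist p (vadd p (vscale t v)) = Rabs t * vnorm v.
Proof.
  unfold edist, vnorm; rewrite <- (sqrt_Rsqr_abs t), <- sqrt_mult_alt by apply Rle_0_sqr.
  f_equal; unfold Rsqr, dot; simpl; ring.
Qed.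

(** * Spherical distance and the thickness of a lune *)

Lemma cos_sdist (a b : vec) : on_S2 a -> on_S2 b -> cos (sdist a b) = dot a b.
Proof. intros Ha Hb; apply cos_acos, dot_S2_le; auto. Qed.

Lemma sdist_le_iff (a b : vec) (w : R) : on_S2 a -> on_S2 b -> 0 <= w <= PI ->
  (sdist a b <= w <-> cos w <= dot a b).
Proof.
  intros Ha Hb Hw; rewrite <- (cos_sdist a b Ha Hb).
  pose proof (acos_bound (dot a b)) as Hac; unfold sdist; split; intros H.
  - apply cos_decr_1; lra.
  - apply cos_decr_0; lra.
Qed.

Lemma sdist_eq_iff (a b : vec) (w : R) : on_S2 a -> on_S2 b -> 0 <= w <= PI ->
  (sdist a b = w <-> dot a b = cos w).
Proof.
  intros Ha Hb Hw; rewrite <- (cos_sdist a b Ha Hb); split; intros H.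
  - now rewrite H.
  - pose proof (acos_bound (dot a b)); apply cos_inj; unfold sdist in *; lra.
Qed.

Lemma lune_pair_dot (g h : vec) : lune_pair g h -> -1 < dot g h < 1.
Proof.
  intros (Hg & Hh & N1 & N2); pose proof (dot_S2_le g h Hg Hh) as B.
  destruct (Req_dec (dot g h) 1) as [E|E].
  { now destruct N1; apply dot_S2_eq1. }
  destruct (Req_dec (dot g h) (-1)) as [E'|E'].
  { now destruct N2; apply dot_S2_eqN1. }
  lra.
Qed.

Definition cross (a b : vec) : vec :=
  V (vy a * vz b - vz a * vy b) (vz a * vx b - vx a * vz b) (vx a * vy b - vy a * vx b).

Lemma dot_cross_l (a b : vec) : dot (cross a b) a = 0.
Proof. unfold dot; simpl; ring. Qed.

Lemma dot_cross_r (a b : vec) : dot (cross a b) b = 0.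
Proof. unfold dot; simpl; ring. Qed.

Lemma dot_cross_self (a b : vec) :
  dot (cross a b) (cross a b) = dot a a * dot b b - dot a b * dot a b.
Proof. unfold dot; simpl; ring. Qed.

(** The endpoints of the semicircle are plus and minus the normalized [cross g h]. Equidistance from
    them makes [c] orthogonal to [cross g h], so [c] lies in the plane of [g] and [h]; being
    orthogonal to [g], it is a multiple of the component of [h] orthogonal to [g]. *)
Lemma semicircle_midpoint_iff (g h c : vec) : lune_pair g h ->
  (semicircle_midpoint g h c <->
   c = vscale (/ sqrt (1 - dot g h * dot g h)) (vadd h (vscale (- dot g h) g))).
Proof.
  intros Hgh; pose proof (lune_pair_dot g h Hgh) as B.
  destruct Hgh as (Hg & Hh & _); unfold is_hemi in *.
  set (y := dot g h) in *; set (s := sqrt (1 - y * y)).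
  assert (Hs : 0 < s) by (apply sqrt_lt_R0; nra).
  assert (Hss : s * s = 1 - y * y) by (apply sqrt_sqrt; nra).
  unfold on_S2 in *; split.
  - intros ((Hc & Hcg) & (_ & Hch) & Heq).
    pose proof (dot_cross_self g h) as Hn; rewrite Hg, Hh in Hn; fold y in Hn.
    assert (Hn0 : 0 < dot (cross g h) (cross g h)) by nra.
    set (e := unit (cross g h)).
    assert (He : on_S2 e) by now apply unit_S2.
    assert (Hen : 0 < vnorm (cross g h)) by now apply vnorm_gt0.
    assert (Heg : dot e g = 0).
    { pose proof (dot_unit _ g Hn0) as E; rewrite dot_cross_l in E; fold e in E; nra. }
    assert (Heh : dot e h = 0).
    { pose proof (dot_unit _ h Hn0) as E; rewrite dot_cross_r in E; fold e in E; nra. }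
    unfold on_S2 in *.
    assert (Hs2 : dot (vopp e) (vopp e) = 1) by (dots; lra).
    assert (D : sdist c e = sdist c (vopp e)).
    { apply Heq; unfold hemi_bd, on_S2; repeat split; auto; try (dots; lra).
      intros E; assert (X : dot e e = dot e (vopp e)) by (rewrite <- E; auto).
      dots; lra. }
    assert (Hce : dot c e = 0).
    { assert (X : dot c (vopp e) = dot c e).
      { rewrite <- (cos_sdist c (vopp e)), <- D, cos_sdist by auto; auto. }
      dots; lra. }
    assert (HcN : dot c (cross g h) = 0).
    { rewrite dot_comm, <- (dot_unit _ c Hn0); fold e; rewrite dot_comm, Hce; ring. }
    (* [c] expanded in the basis [g], [h], [cross g h] *)
    assert (Hexp : vscale (dot g g * dot h h - y * y) c =
      vadd (vadd (vscale (dot c g * dot h h - y * dot c h) g)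
                 (vscale (dot c h * dot g g - y * dot c g) h))
           (vscale (dot c (cross g h)) (cross g h))).
    { unfold y; apply vec_eq; unfold dot; simpl; ring. }
    rewrite Hg, Hh, Hcg, HcN in Hexp.
    assert (Hc2 : vscale (s * s) c = vscale (dot c h) (vadd h (vscale (- y) g))).
    { rewrite Hss; injection Hexp; intros; apply vec_eq; simpl; lra. }
    (* Comparing norms gives [dot c h] up to sign; [c] being in the hemisphere [h] fixes the
       sign. *)
    assert (Hcs : dot c h = s).
    { assert (X : dot (vscale (s * s) c) (vscale (s * s) c) =
        dot (vscale (dot c h) (vadd h (vscale (- y) g)))
            (vscale (dot c h) (vadd h (vscale (- y) g)))) by now rewrite Hc2.
      dots; rewrite Hc, Hg, Hh, (dot_comm h g) in X; fold y in X.
      set (m := dot c h) in *.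
      assert (X1 : (s * s) * (s * s) = (m * m) * (1 - y * y)) by lra.
      rewrite <- Hss in X1.
      assert (s * s = m * m) by (apply Rmult_eq_reg_r with (s * s); nra).
      nra. }
    rewrite Hcs in Hc2; injection Hc2; intros E3 E2 E1.
    apply vec_eq; simpl; apply Rmult_eq_reg_l with (s * s); try nra.
    all: rewrite ?E1, ?E2, ?E3; field; lra.
  - intros ->; unfold semicircle_midpoint, hemi_bd, hemi, on_S2.
    dots; rewrite ?(dot_comm h g), ?Hg, ?Hh; fold y.
    assert (Hi : / s * s = 1) by (field; lra).
    assert (0 < / s) by now apply Rinv_0_lt_compat.
    assert (Hii : / s * / s * (1 - y * y) = 1) by (rewrite <- Hss; field; lra).
    repeat split; try nra.
    intros e1 e2 [_ A1] [_ A2] [_ A3] [_ A4] _; unfold sdist; f_equal; dots.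
    rewrite (dot_comm h e1), (dot_comm g e1), (dot_comm h e2), (dot_comm g e2); nra.
Qed.

(** With both midpoints explicit, their inner product simplifies to [- dot g h]. *)
Lemma lune_thickness_iff (g h : vec) (w : R) :
  lune_thickness g h w <-> lune_pair g h /\ w = acos (- dot g h).
Proof.
  assert (S : lune_pair g h -> lune_pair h g).
  { intros (A & B & C & D); repeat split; auto.
    intros E; apply D; rewrite E; apply vec_eq; simpl; ring. }
  assert (E : lune_pair g h ->
    sdist (vscale (/ sqrt (1 - dot g h * dot g h)) (vadd h (vscale (- dot g h) g)))
          (vscale (/ sqrt (1 - dot h g * dot h g)) (vadd g (vscale (- dot h g) h)))
    = acos (- dot g h)).
  { intros L; pose proof (lune_pair_dot g h L) as B.
    destruct L as (Hg & Hh & _); unfold is_hemi, on_S2 in *.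
    unfold sdist; f_equal; rewrite (dot_comm h g); dots.
    rewrite (dot_comm h g), Hg, Hh; set (y := dot g h) in *.
    assert (Hs : 0 < sqrt (1 - y * y)) by (apply sqrt_lt_R0; nra).
    assert (Hss : sqrt (1 - y * y) * sqrt (1 - y * y) = 1 - y * y) by (apply sqrt_sqrt; nra).
    apply Rmult_eq_reg_r with (sqrt (1 - y * y) * sqrt (1 - y * y)); [|nra].
    transitivity (- y * (1 - y * y)); [field; lra | rewrite Hss; ring]. }
  split.
  - intros (L & c1 & c2 & M1 & M2 & ->); split; auto.
    apply semicircle_midpoint_iff in M1; auto; apply semicircle_midpoint_iff in M2; auto.
    subst; auto.
  - intros (L & ->); split; auto; do 2 eexists; split; [|split].
    + apply semicircle_midpoint_iff; auto.
    + apply semicircle_midpoint_iff; auto.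
    + symmetry; auto.
Qed.

(** * The trace of the dual cone of [D] on the sphere, and the width *)

Definition polar (D : vec -> Prop) (k : vec) : Prop :=
  on_S2 k /\ forall x, D x -> 0 <= dot x k.

Lemma polar_subset_hemi (D : vec -> Prop) (k : vec) : (forall x, D x -> on_S2 x) ->
  (polar D k <-> is_hemi k /\ subset D (hemi k)).
Proof.
  intros HD; unfold polar, is_hemi, subset, hemi; split.
  - intros [H1 H2]; repeat split; auto; apply HD; auto.
  - intros [H1 H2]; split; auto; intros x Hx; apply H2; auto.
Qed.

(* Dualizes the width: over the supporting hemispheres this says that the polar has
   constant diameter [PI - w]. *)
Lemma width_is_polar (D : vec -> Prop) (k : vec) (w : R) :
  (forall x, D x -> on_S2 x) -> 0 < w < PI -> polar D k -> ~ polar D (vopp k) ->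
  (width_is k D w <->
   (exists h, polar D h /\ dot k h = - cos w) /\
   (forall h, polar D h -> - cos w <= dot k h)).
Proof.
  intros HD Hw Hk HkN.
  assert (Hc : -1 < cos w < 1).
  { split; [rewrite <- cos_PI | rewrite <- cos_0]; apply cos_decreasing_1; lra. }
  assert (Hlune : forall h, lune_pair k h -> subset D (lune k h) -> polar D h).
  { intros h (_ & Hh & _) Hs; apply polar_subset_hemi; auto; split; auto.
    intros x Hx; apply Hs; auto. }
  assert (Hpair : forall h, polar D h -> h <> k -> lune_pair k h).
  { intros h Hh Hn; split; [apply Hk|split; [apply Hh|split; auto]].
    intros ->; auto. }
  assert (Hsub : forall h, polar D h -> subset D (lune k h)).
  { intros h Hh x Hx; split; split; auto; [now apply Hk | now apply Hh]. }
  split.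
  - intros [(h & Ht & Hs) Hmin]; split.
    + exists h; apply lune_thickness_iff in Ht; destruct Ht as [L ->].
      split; [now apply Hlune|].
      pose proof (lune_pair_dot _ _ L); rewrite cos_acos; lra.
    (* The pair [k], [k] forms no lune, but there the inner product is 1 and the bound is clear. *)
    + intros h' Hh'; destruct (classic (h' = k)) as [->|N].
      { replace (dot k k) with 1 by (symmetry; apply Hk); lra. }
      assert (L : lune_pair k h') by auto.
      pose proof (lune_pair_dot _ _ L).
      assert (Hle : w <= acos (- dot k h')).
      { apply (Hmin h'); auto; apply lune_thickness_iff; auto. }
      pose proof (acos_bound (- dot k h')).
      apply cos_decr_1 in Hle; try lra; rewrite cos_acos in Hle; lra.
  - intros [(h & Hh & E) Hmin]; split.
    + exists h; split; auto; apply lune_thickness_iff; split.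
      * apply Hpair; auto; intros ->.
        assert (dot k k = 1) by apply Hk; lra.
      * rewrite E, Ropp_involutive, acos_cos; lra.
    + intros h' w' Ht Hs; apply lune_thickness_iff in Ht; destruct Ht as [L ->].
      pose proof (lune_pair_dot _ _ L); specialize (Hmin h' (Hlune h' L Hs)).
      pose proof (acos_bound (- dot k h')).
      apply cos_decr_0; try lra; rewrite cos_acos; lra.
Qed.

(** * Perturbing interior points *)

Lemma on_S2_shift (q v : vec) (e : R) : on_S2 q -> on_S2 v -> 0 <= e < 1 ->
  1 - e <= vnorm (vadd q (vscale (- e) v)) /\ 0 < dot (vadd q (vscale (- e) v)) (vadd q (vscale (- e) v)).
Proof.
  intros Hq Hv He; set (w := vadd q (vscale (- e) v)).
  pose proof (dot_S2_le q v Hq Hv).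
  assert (E : dot w w = 1 - 2 * e * dot q v + e * e).
  { unfold w; dots; rewrite (dot_comm v q), Hq, Hv; ring. }
  pose proof (vnorm_sqr w); pose proof (vnorm_ge0 w).
  split; [|]; nra.
Qed.

Lemma interior_shift (D : vec -> Prop) (q v : vec) :
  on_S2 q -> on_S2 v -> interior_pt D q ->
  exists e, 0 < e < 1 /\ D (unit (vadd q (vscale (- e) v))).
Proof.
  intros Hq Hv (eps & Heps & H).
  (* Projection at most doubles the displacement, so [eps / 4] keeps the point within [eps]; [1 / 2]
     keeps the shifted vector away from 0. *)
  exists (Rmin (1 / 2) (eps / 4)).
  assert (He : 0 < Rmin (1 / 2) (eps / 4)) by (apply Rmin_pos; lra).
  pose proof (Rmin_l (1 / 2) (eps / 4)); pose proof (Rmin_r (1 / 2) (eps / 4)).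
  set (e := Rmin (1 / 2) (eps / 4)) in *; split; [lra|].
  destruct (on_S2_shift q v e) as [_ Hw]; auto; [lra|].
  apply H; [now apply unit_S2|].
  pose proof (edist_unit q _ Hq Hw) as B.
  rewrite edist_shift, (vnorm_S2 v Hv), Rabs_Ropp, Rabs_pos_eq in B; lra.
Qed.

(** A small push of [q] away from the pole [k] stays in [D], hence in the hemisphere [k], so [q]
    cannot lie on its boundary. *)
Lemma polar_interior_gt0 (D : vec -> Prop) (q k : vec) :
  on_S2 q -> interior_pt D q -> polar D k -> 0 < dot q k.
Proof.
  intros Hq Hi [Hk Hpos].
  destruct (interior_shift D q k Hq Hk Hi) as (e & He & HDe).
  destruct (on_S2_shift q k e) as [Hn Hw]; auto; [lra|].
  specialize (Hpos _ HDe); pose proof (dot_unit _ k Hw) as E.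
  revert E; rewrite dot_vadd_l, dot_vscale_l, Hk; intros E; nra.
Qed.

(** Excludes opposite hemispheres, so that distinct members of the polar form a lune. *)
Lemma polar_vopp (D : vec -> Prop) (q k : vec) :
  on_S2 q -> interior_pt D q -> polar D k -> ~ polar D (vopp k).
Proof.
  intros Hq Hi Hk HkN.
  pose proof (polar_interior_gt0 D q k Hq Hi Hk) as H1.
  pose proof (polar_interior_gt0 D q _ Hq Hi HkN) as H2.
  dots; lra.
Qed.

(** Strict because [q] can still be pushed away from [x] inside [D]. *)
Lemma interior_dot_gt (D : vec -> Prop) (c : R) (q x : vec) :
  (forall y z, D y -> D z -> c <= dot y z) -> 0 <= c < 1 ->
  on_S2 q -> interior_pt D q -> on_S2 x -> D x -> c < dot q x.
Proof.
  intros Hd Hc Hq Hi Hx HDx.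
  destruct (interior_shift D q x Hq Hx Hi) as (e & He & HDe).
  destruct (on_S2_shift q x e) as [Hn Hw]; auto; [lra|].
  specialize (Hd _ _ HDe HDx); pose proof (dot_unit _ x Hw) as E.
  revert E; rewrite dot_vadd_l, dot_vscale_l, Hx; intros E; nra.
Qed.

(** * Boundary points on arcs, and completeness *)

Lemma unit_continuous (w v : vec) : 0 < dot w w -> forall eps, 0 < eps ->
  exists eta, 0 < eta /\ forall t, Rabs t < eta ->
    0 < dot (vadd w (vscale t v)) (vadd w (vscale t v)) ->
    edist (unit w) (unit (vadd w (vscale t v))) < eps.
Proof.
  intros Hw eps Heps; pose proof (vnorm_gt0 w Hw) as Hn; pose proof (vnorm_ge0 v) as Hv.
  (* After rescaling [w] to norm 1, [edist_unit] bounds the distance by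
     [2 * Rabs t * vnorm v / vnorm w]; the [+ 1] covers [v = 0]. *)
  exists (eps * vnorm w / (2 * (vnorm v + 1))); split.
  { apply Rdiv_lt_0_compat; nra. }
  intros t Ht Hpos.
  assert (E : vscale (/ vnorm w) (vadd w (vscale t v)) =
              vadd (unit w) (vscale (t / vnorm w) v)).
  { apply vec_eq; simpl; field; lra. }
  assert (0 < / vnorm w) by now apply Rinv_0_lt_compat.
  rewrite <- (unit_vscale (/ vnorm w) (vadd w (vscale t v))), E by auto.
  eapply Rle_lt_trans; [apply edist_unit|].
  - now apply unit_S2.
  - rewrite <- E, dot_vscale_l, dot_vscale_r; repeat apply Rmult_lt_0_compat; auto.
  - rewrite edist_shift; unfold Rdiv; rewrite Rabs_mult, (Rabs_pos_eq (/ vnorm w)) by lra.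
    apply Rmult_lt_reg_r with (vnorm w); auto.
    replace (2 * (Rabs t * / vnorm w * vnorm v) * vnorm w) with (2 * Rabs t * vnorm v)
      by (field; lra).
    apply Rmult_lt_compat_r with (r := 2 * (vnorm v + 1)) in Ht; [|lra].
    replace (eps * vnorm w / (2 * (vnorm v + 1)) * (2 * (vnorm v + 1)))
      with (eps * vnorm w) in Ht by (field; lra).
    pose proof (Rabs_pos t); nra.
Qed.

(** Parametrizes the chord linearly; for [t] in [0,1], [unit] sends it to the arc from [q] to
    [z]. *)
Definition ray (q z : vec) (t : R) : vec := vadd q (vscale t (vadd z (vopp q))).

Lemma dot_ray (q z a : vec) (t : R) : dot (ray q z t) a = (1 - t) * dot q a + t * dot z a.
Proof. unfold ray; dots; ring. Qed.

Lemma dot_ray_self (q z : vec) (t : R) : on_S2 q -> on_S2 z ->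
  dot (ray q z t) (ray q z t) = 1 - 2 * t * (1 - t) * (1 - dot q z).
Proof.
  intros Hq Hz; rewrite dot_ray, (dot_comm q), (dot_comm z), !dot_ray, (dot_comm z q), Hq, Hz.
  ring.
Qed.

(** Take the supremum of the parameters whose arc point is in [D]: closedness keeps that point in
    [D], and points just beyond it are outside. The bound on [dot q z] keeps the chord off the
    origin. *)
Lemma boundary_crossing (D : vec -> Prop) (q z : vec) :
  closed_S2 D -> on_S2 q -> on_S2 z -> -1 < dot q z -> D q -> ~ D z ->
  exists t, 0 <= t < 1 /\ boundary_pt D (unit (ray q z t)).
Proof.
  intros Hcl Hq Hz Hqz HDq HDz.
  assert (Hpos : forall t, 0 <= t <= 1 -> 0 < dot (ray q z t) (ray q z t)).
  { intros t Ht; rewrite dot_ray_self; auto.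
    pose proof (dot_S2_le q z Hq Hz).
    (* Hence the squared norm is at least [(1 + dot q z) / 2]. *)
    assert (2 * t * (1 - t) <= 1 / 2) by (pose proof (Rle_0_sqr (2 * t - 1)); unfold Rsqr in *; lra).
    assert (0 <= 2 * t * (1 - t)) by nra.
    set (X := 2 * t * (1 - t)) in *; nra. }
  assert (Hcont : forall t, 0 <= t <= 1 -> forall eps, 0 < eps -> exists eta, 0 < eta /\
     forall u, 0 <= u <= 1 -> Rabs (u - t) < eta ->
       edist (unit (ray q z t)) (unit (ray q z u)) < eps).
  { intros t Ht eps Heps.
    destruct (unit_continuous (ray q z t) (vadd z (vopp q)) (Hpos t Ht) eps Heps)
      as (eta & Heta & H).
    exists eta; split; auto; intros u Hu Hut.
    assert (E : ray q z u = vadd (ray q z t) (vscale (u - t) (vadd z (vopp q)))).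
    { apply vec_eq; simpl; ring. }
    specialize (Hpos u Hu); rewrite E in *; auto. }
  set (T := fun t => 0 <= t <= 1 /\ D (unit (ray q z t))).
  assert (T0 : T 0).
  { split; [lra|]; replace (ray q z 0) with q by (apply vec_eq; simpl; ring).
    rewrite unit_id; auto. }
  destruct (completeness T) as [t [Hub Hlub]].
  { exists 1; intros t [Ht _]; lra. }
  { now exists 0. }
  assert (Ht : 0 <= t <= 1).
  { split; [now apply Hub | apply Hlub; intros u [Hu _]; lra]. }
  assert (HDt : D (unit (ray q z t))).
  { apply NNPP; intros HN.
    destruct (Hcl _ (unit_S2 _ (Hpos t Ht)) HN) as (eps & Heps & Hout).
    destruct (Hcont t Ht eps Heps) as (eta & Heta & H).
    assert (t <= t - eta); [|lra].
    apply Hlub; intros u [Hu HDu].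
    destruct (Rle_dec u (t - eta)) as [|Hnu]; auto; exfalso.
    assert (u <= t) by (apply Hub; split; auto).
    apply (Hout (unit (ray q z u))); auto; [apply unit_S2; auto|].
    apply H; auto; apply Rabs_def1; lra. }
  assert (Ht1 : t < 1).
  { destruct (Req_dec t 1) as [->|]; [|lra].
    destruct HDz; replace z with (ray q z 1) by (apply vec_eq; simpl; ring).
    rewrite <- unit_id; auto.
    replace (ray q z 1) with z by (apply vec_eq; simpl; ring); auto. }
  exists t; split; [lra|]; split; [apply unit_S2; auto|split; auto].
  intros eps Heps; destruct (Hcont t Ht eps Heps) as (eta & Heta & H).
  set (u := t + Rmin (eta / 2) (1 - t)).
  pose proof (Rmin_l (eta / 2) (1 - t)); pose proof (Rmin_r (eta / 2) (1 - t)).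
  assert (0 < Rmin (eta / 2) (1 - t)) by (apply Rmin_pos; lra).
  assert (Hu : 0 <= u <= 1) by (unfold u; lra).
  exists (unit (ray q z u)); split; [apply unit_S2; auto|split].
  - apply H; auto; apply Rabs_def1; unfold u; lra.
  - intros HDu; assert (u <= t); [apply Hub; split; auto | unfold u in *; lra].
Qed.

Lemma constant_diameter_complete (D : vec -> Prop) (c : R) (q z : vec) :
  (forall x, D x -> on_S2 x) -> closed_S2 D -> 0 <= c < 1 ->
  (forall x y, D x -> D y -> c <= dot x y) ->
  (forall p, boundary_pt D p -> exists p', D p' /\ dot p p' = c) ->
  D q -> interior_pt D q ->
  on_S2 z -> (forall x, D x -> c <= dot z x) -> D z.
Proof.
  intros HD Hcl Hc Hd Hbd HDq Hiq Hz Hzx; apply NNPP; intros HN.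
  assert (Hqz : -1 < dot q z) by (rewrite dot_comm; specialize (Hzx q HDq); lra).
  destruct (boundary_crossing D q z) as (t & Ht & Hp); auto.
  destruct (Hbd _ Hp) as (p' & HDp' & E).
  assert (Hw1 : dot (ray q z t) (ray q z t) <= 1).
  { rewrite dot_ray_self by auto.
    pose proof (dot_S2_le q z (HD q HDq) Hz).
    assert (0 <= 2 * t * (1 - t) * (1 - dot q z)); [|lra].
    repeat apply Rmult_le_pos; lra. }
  (* Strict because [t < 1] gives the interior point [q] positive weight. The chord lies in the unit
     ball, so normalizing cannot lower this value, contradicting [E]. *)
  assert (Hlow : c < dot (ray q z t) p').
  { rewrite dot_ray; specialize (Hzx p' HDp').
    pose proof (interior_dot_gt D c q p' Hd Hc (HD q HDq) Hiq (HD p' HDp') HDp').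
    nra. }
  assert (Hw0 : 0 < dot (ray q z t) (ray q z t)).
  { pose proof (dot_sqr_le (ray q z t) p') as B; rewrite (HD p' HDp') in B; nra. }
  rewrite <- dot_unit in Hlow by auto; rewrite E in Hlow.
  pose proof (vnorm_ge0 (ray q z t)); pose proof (vnorm_sqr (ray q z t)).
  assert (vnorm (ray q z t) <= 1) by nra; nra.
Qed.

(** * From constant diameter to constant width *)

Definition opposite (c : R) (p k : vec) : vec :=
  vadd (vscale c p) (vscale (sqrt (1 - c * c)) k).

Lemma dot_opposite (c : R) (p k a : vec) :
  dot (opposite c p k) a = c * dot p a + sqrt (1 - c * c) * dot k a.
Proof. unfold opposite; dots; ring. Qed.

(** [opposite c p k] is the point at distance [acos c] from [p] on the great circle from [p] towards
    the pole [k]. If some [x] of [D] were farther than [acos c] from it, a slight move of [p] would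
    give a point outside the hemisphere [k] which completeness nevertheless puts into [D]. *)
Lemma complete_support_ball (D : vec -> Prop) (c : R) (p k x : vec) :
  (forall y, D y -> on_S2 y) -> 0 < c < 1 ->
  (forall y z, D y -> D z -> c <= dot y z) ->
  (forall z, on_S2 z -> (forall y, D y -> c <= dot z y) -> D z) ->
  polar D k -> D p -> dot p k = 0 -> D x -> c <= dot (opposite c p k) x.
Proof.
  intros HD Hc Hd Hcomp [Hk Hpos] HDp Hpk HDx.
  rewrite dot_opposite; set (s := sqrt (1 - c * c)).
  assert (Hs : 0 < s) by (apply sqrt_lt_R0; nra).
  assert (Hss : s * s = 1 - c * c) by (apply sqrt_sqrt; nra).
  destruct (Rle_dec c (c * dot p x + s * dot k x)) as [|HN]; auto; exfalso.
  assert (Hp : on_S2 p) by auto.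
  set (d := 1 - dot p x); set (xi := dot x k).
  assert (Hxi : s * xi < c * d) by (unfold d, xi; rewrite (dot_comm x k); lra).
  assert (0 <= xi) by (apply Hpos; auto).
  (* Moving from [p] in the direction [v] keeps distance at most [acos c] to [D] but leaves
     the hemisphere [k]. *)
  set (mu := (xi / (s * c) + d / (s * s)) / 2).
  (* [dot v k < 0] needs [mu] above the left side, [dot v p < 0] needs it below the right side;
     [Hxi] says exactly that there is room, and [mu] is the midpoint. *)
  assert (Hgap : xi / (s * c) < d / (s * s)).
  { apply Rmult_lt_reg_r with (s * s * c); [nra|].
    replace (xi / (s * c) * (s * s * c)) with (s * xi) by (field; lra).
    replace (d / (s * s) * (s * s * c)) with (c * d) by (field; lra); auto. }
  assert (Hmu0 : 0 <= xi / (s * c)) by (apply Rle_mult_inv_pos; nra).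
  assert (Hmu1 : xi < mu * (s * c)).
  { replace xi with (xi / (s * c) * (s * c)) at 1 by (field; lra).
    apply Rmult_lt_compat_r; [nra | unfold mu; lra]. }
  assert (Hmu2 : mu * (s * s) < d).
  { replace d with (d / (s * s) * (s * s)) at 1 by (field; lra).
    apply Rmult_lt_compat_r; [nra | unfold mu; lra]. }
  assert (Hmu : 0 <= mu) by (unfold mu; lra).
  set (v := vadd (vadd x (vopp p)) (vscale mu (vadd p (vscale (- c) (opposite c p k))))).
  assert (Hkp : dot k p = 0) by now rewrite dot_comm.
  assert (Hpv : dot v p < 0).
  { unfold v; dots; rewrite dot_opposite; fold s; rewrite Hkp, Hp, (dot_comm x p).
    unfold d in *; nra. }
  assert (Hvk : dot v k < 0).
  { unfold v; dots; rewrite dot_opposite; fold s; rewrite Hk, Hpk; fold xi; nra. }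
  (* The chord from [p] to [x] contributes at least [c - dot p y], and the [mu] term is nonnegative
     because [dot p y >= c] while [opposite c p k] is a unit vector. *)
  assert (Hvy : forall y, D y -> c - dot p y <= dot v y).
  { intros y HDy; unfold v; dots; pose proof (Hd x y HDx HDy); pose proof (Hd p y HDp HDy).
    assert (Hp' : dot (opposite c p k) y <= 1).
    { apply dot_S2_le; auto; unfold on_S2; rewrite dot_opposite; fold s.
      rewrite (dot_comm p), (dot_comm k), !dot_opposite; fold s.
      rewrite Hp, Hk, Hpk, Hkp; nra. }
    assert (0 <= mu * (dot p y - c * dot (opposite c p k) y)) by (apply Rmult_le_pos; nra).
    nra. }
  (* [b <= 1] preserves the bound [c] for [w]; the other bound gives [dot w w <= 1], so that
     normalizing [w] does not lower its inner products with [D]. *)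
  set (b := Rmin 1 (- dot v p / (dot v v + 1))).
  pose proof (dot_self_ge0 v) as Hvv.
  assert (Hb0 : 0 < b).
  { apply Rmin_pos; [lra | apply Rdiv_lt_0_compat; lra]. }
  assert (Hb1 : b <= 1) by apply Rmin_l.
  assert (Hb2 : b * (dot v v + 1) <= - dot v p).
  { replace (- dot v p) with (- dot v p / (dot v v + 1) * (dot v v + 1)) by (field; lra).
    apply Rmult_le_compat_r; [lra | apply Rmin_r]. }
  set (w := vadd p (vscale b v)).
  assert (Hww : dot w w <= 1).
  { unfold w; dots; rewrite (dot_comm p v), Hp; nra. }
  assert (Hwy : forall y, D y -> c <= dot w y).
  { intros y HDy; unfold w; dots; specialize (Hvy y HDy); pose proof (Hd p y HDp HDy); nra. }
  assert (Hw0 : 0 < dot w w).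
  { pose proof (dot_sqr_le w p) as B; pose proof (Hwy p HDp); rewrite Hp in B; nra. }
  pose proof (vnorm_gt0 w Hw0); pose proof (vnorm_sqr w).
  assert (vnorm w <= 1) by nra.
  assert (HDw : D (unit w)).
  { apply Hcomp; [now apply unit_S2|]; intros y HDy.
    specialize (Hwy y HDy); rewrite <- dot_unit in Hwy by auto; nra. }
  specialize (Hpos _ HDw); pose proof (dot_unit w k Hw0) as E.
  assert (dot w k < 0) by (unfold w; dots; rewrite Hpk; nra).
  nra.
Qed.

(** The minimum is attained at [s * p - c * k], whose boundary passes through [opposite c p k];
    points within [acos c] of [p] have [k]-coordinate at most [s], so it contains [D]. The lower
    bound follows from the hemisphere [h] containing both [p] and [opposite c p k], together with
    Bessel's inequality. *)
Lemma support_width (D : vec -> Prop) (c : R) (p k : vec) :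
  (forall y, D y -> on_S2 y) -> 0 < c < 1 ->
  (forall y, D y -> c <= dot p y) ->
  polar D k -> D p -> dot p k = 0 -> D (opposite c p k) ->
  (exists h, polar D h /\ dot k h = - c) /\ (forall h, polar D h -> - c <= dot k h).
Proof.
  intros HD Hc Hd [Hk Hpos] HDp Hpk HDo.
  set (s := sqrt (1 - c * c)).
  assert (Hs : 0 < s) by (apply sqrt_lt_R0; nra).
  assert (Hss : s * s = 1 - c * c) by (apply sqrt_sqrt; nra).
  assert (Hp : on_S2 p) by auto.
  assert (Hkp : dot k p = 0) by now rewrite dot_comm.
  split.
  - exists (vadd (vscale s p) (vscale (- c) k)); split; [split|].
    + unfold on_S2; dots; rewrite Hp, Hk, Hkp, Hpk; nra.
    + intros x HDx; dots; pose proof (bessel2 p k x Hp Hk Hpk (HD x HDx)).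
      specialize (Hpos x HDx); specialize (Hd x HDx); rewrite dot_comm in Hd.
      set (a := dot x p) in *; set (b := dot x k) in *.
      assert (b <= s) by nra; nra.
    + dots; rewrite Hkp, Hk; ring.
  - intros h [Hh Hhpos].
    pose proof (Hhpos p HDp) as H1; pose proof (Hhpos _ HDo) as H2.
    rewrite dot_opposite in H2; fold s in H2.
    pose proof (bessel2 p k h Hp Hk Hpk Hh) as H3.
    rewrite (dot_comm h p), (dot_comm h k) in H3.
    set (a := dot p h) in *; set (b := dot k h) in *.
    destruct (Rle_dec (- c) b) as [|HN]; auto; exfalso.
    assert (a < s) by nra; nra.
Qed.

(** * Compactness on the sphere, with nested families in place of sequences *)

Lemma decreasing_family_limit (T : Type) (F : R -> T -> Prop) (f : T -> R) (M : R) :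
  (forall e e' y, 0 < e <= e' -> F e y -> F e' y) ->
  (forall e, 0 < e -> exists y, F e y) ->
  (forall e y, F e y -> - M <= f y <= M) ->
  exists l, forall e, 0 < e -> exists y, F e y /\ Rabs (f y - l) < e.
Proof.
  intros Hmono Hne HM.
  (* [l] is the lower limit of [f] along [F] as [e] tends to 0. *)
  destruct (completeness (fun r => exists e, 0 < e /\ forall y, F e y -> r <= f y))
    as [l [Hub Hlub]].
  { exists M; intros r (e & He & H); destruct (Hne e He) as [y Hy].
    specialize (H y Hy); specialize (HM e y Hy); lra. }
  { exists (- M), 1; split; [lra|]; intros y Hy; apply (HM 1 y Hy). }
  exists l; intros e He.
  destruct (classic (exists r, l - e < r /\ exists e0, 0 < e0 /\ forall y, F e0 y -> r <= f y))
    as [(r & Hr & e0 & He0 & H)|HN].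
  - pose proof (Rmin_pos e e0 He He0); pose proof (Rmin_l e e0); pose proof (Rmin_r e e0).
    destruct (classic (exists y, F (Rmin e e0) y /\ f y < l + e)) as [(y & Hy & Hlt)|HN].
    + exists y; split; [eapply Hmono; [|exact Hy]; lra|].
      assert (r <= f y) by (apply H; eapply Hmono; [|exact Hy]; lra).
      apply Rabs_def1; lra.
    + assert (l + e <= l); [|lra].
      apply Hub; exists (Rmin e e0); split; auto; intros y Hy.
      destruct (Rle_dec (l + e) (f y)); auto; destruct HN; exists y; split; auto; lra.
  - assert (l <= l - e); [|lra].
    apply Hlub; intros r Hr; destruct (Rle_dec r (l - e)); auto.
    destruct HN; exists r; split; auto; lra.
Qed.

(** The refined family is again nested and nonempty, so the step can be repeated for each
    coordinate. *)
Lemma decreasing_family_refine (T : Type) (F : R -> T -> Prop) (f : T -> R) (M : R) :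
  (forall e e' y, 0 < e <= e' -> F e y -> F e' y) ->
  (forall e, 0 < e -> exists y, F e y) ->
  (forall e y, F e y -> - M <= f y <= M) ->
  exists l, let G := fun e y => F e y /\ Rabs (f y - l) < e in
    (forall e e' y, 0 < e <= e' -> G e y -> G e' y) /\
    (forall e, 0 < e -> exists y, G e y).
Proof.
  intros Hmono Hne HM; destruct (decreasing_family_limit T F f M Hmono Hne HM) as [l Hl].
  exists l; split; auto.
  intros e e' y He [H1 H2]; split; [eapply Hmono; eauto | lra].
Qed.

Lemma coord_le (y : vec) : on_S2 y ->
  -1 <= vx y <= 1 /\ -1 <= vy y <= 1 /\ -1 <= vz y <= 1.
Proof. unfold on_S2, dot; intros; nra. Qed.

Lemma vnorm_le_coord (v : vec) (e : R) : 0 < e ->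
  Rabs (vx v) < e -> Rabs (vy v) < e -> Rabs (vz v) < e -> vnorm v <= 2 * e.
Proof.
  intros He H1 H2 H3; apply Rabs_def2 in H1; apply Rabs_def2 in H2; apply Rabs_def2 in H3.
  pose proof (vnorm_sqr v) as E; pose proof (vnorm_ge0 v); unfold dot in E.
  assert (vx v * vx v <= e * e) by nra; assert (vy v * vy v <= e * e) by nra.
  assert (vz v * vz v <= e * e) by nra; nra.
Qed.

Lemma le_of_all_small (a b C : R) :
  (forall e, 0 < e < 1 -> a <= b + C * e) -> a <= b.
Proof.
  intros H; destruct (Rle_dec a b) as [|HN]; auto.
  set (e := Rmin (1 / 2) ((a - b) / (2 * (Rabs C + 1)))).
  pose proof (Rabs_pos C); pose proof (Rle_abs C).
  assert (He : 0 < e) by (apply Rmin_pos; [lra | apply Rdiv_lt_0_compat; lra]).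
  assert (He1 : e <= 1 / 2) by apply Rmin_l.
  assert (He2 : e * (2 * (Rabs C + 1)) <= a - b).
  { replace (a - b) with ((a - b) / (2 * (Rabs C + 1)) * (2 * (Rabs C + 1))) by (field; lra).
    apply Rmult_le_compat_r; [lra | apply Rmin_r]. }
  specialize (H e ltac:(lra)); nra.
Qed.

Lemma closed_S2_argmin (A : vec -> Prop) (a : vec) :
  (forall x, A x -> on_S2 x) -> closed_S2 A -> (exists x, A x) ->
  exists y, A y /\ forall x, A x -> dot y a <= dot x a.
Proof.
  intros HA Hcl [x0 Hx0].
  destruct (completeness (fun r => forall x, A x -> r <= dot x a)) as [m [Hub Hlub]].
  { exists (dot x0 a); intros r Hr; auto. }
  { exists (- vnorm a); intros x Hx; pose proof (dot_le x a) as B.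
    rewrite (vnorm_S2 x) in B by auto; lra. }
  assert (Hm : forall x, A x -> m <= dot x a) by (intros x Hx; apply Hlub; intros r Hr; auto).
  (* Near-minimizers; refining by the three coordinates produces the point [l] that they
     approach. *)
  set (F := fun e y => A y /\ dot y a < m + e).
  assert (Fmono : forall e e' y, 0 < e <= e' -> F e y -> F e' y).
  { unfold F; intros e e' y He [H1 H2]; split; auto; lra. }
  assert (Fne : forall e, 0 < e -> exists y, F e y).
  { intros e He; apply NNPP; intros HN; assert (m + e <= m); [|lra].
    apply Hub; intros x Hx; destruct (Rle_dec (m + e) (dot x a)); auto.
    destruct HN; exists x; split; auto; lra. }
  assert (HF : forall e y, F e y -> on_S2 y) by (intros e y [H _]; auto).
  destruct (decreasing_family_refine vec F vx 1 Fmono Fne) as (lx & Gmono & Gne).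
  { intros e y Hy; apply coord_le; eauto. }
  destruct (decreasing_family_refine vec _ vy 1 Gmono Gne) as (ly & Hmono & Hne).
  { intros e y [Hy _]; apply coord_le; eauto. }
  destruct (decreasing_family_refine vec _ vz 1 Hmono Hne) as (lz & _ & Hlim).
  { intros e y [[Hy _] _]; apply coord_le; eauto. }
  set (l := V lx ly lz).
  assert (Hl : forall e, 0 < e -> exists y, A y /\ dot y a < m + e /\ edist l y <= 2 * e).
  { intros e He; destruct (Hlim e He) as (y & (((HAy & Hy) & H1) & H2) & H3).
    exists y; repeat split; auto; apply vnorm_le_coord; auto; unfold vopp, l; simpl.
    all: rewrite Rabs_minus_sym in *.
    - replace (lx + -1 * vx y) with (lx - vx y) by ring; auto.
    - replace (ly + -1 * vy y) with (ly - vy y) by ring; auto.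
    - replace (lz + -1 * vz y) with (lz - vz y) by ring; auto. }
  assert (Hnear : forall e, 0 < e < 1 -> exists y v, A y /\ dot y a < m + e /\
      l = vadd y v /\ vnorm v <= 2 * e /\ edist l y <= 2 * e).
  { intros e He; destruct (Hl e ltac:(lra)) as (y & H1 & H2 & H3).
    exists y, (vadd l (vopp y)); repeat split; auto.
    apply vec_eq; simpl; ring. }
  assert (HlS : on_S2 l).
  (* With [l = y + v] and [vnorm v <= 2 * e], the squared norm of [l] lies between [1 - 4 * e] and
     [1 + 4 * e + 4 * (e * e)], the latter at most [1 + 8 * e]. *)
  { unfold on_S2; apply Rle_antisym.
    - apply le_of_all_small with 8; intros e He.
      destruct (Hnear e He) as (y & v & HAy & _ & E & Hv & _).
      pose proof (dot_le y v) as B; rewrite (vnorm_S2 y) in B by auto.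
      pose proof (vnorm_sqr v); pose proof (vnorm_ge0 v).
      rewrite E; dots; rewrite (HA y HAy), (dot_comm v y); nra.
    - apply le_of_all_small with 4; intros e He.
      destruct (Hnear e He) as (y & v & HAy & _ & E & Hv & _).
      pose proof (dot_le y v) as B; rewrite (vnorm_S2 y) in B by auto.
      pose proof (dot_self_ge0 v).
      rewrite E; dots; rewrite (HA y HAy), (dot_comm v y); nra. }
  exists l; split.
  - apply NNPP; intros HN; destruct (Hcl l HlS HN) as (eps & Heps & Hout).
    destruct (Hl (eps / 4) ltac:(lra)) as (y & HAy & _ & H).
    apply (Hout y); auto; lra.
  - intros x Hx; apply Rle_trans with m; auto.
    apply le_of_all_small with (1 + 2 * vnorm a); intros e He.
    destruct (Hnear e He) as (y & v & HAy & Hy & E & Hv & _).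
    pose proof (dot_le v a); pose proof (vnorm_ge0 a); rewrite E; dots; nra.
Qed.

(** * First-order conditions, separation and the bipolar theorem *)

Lemma dot_ray_gt0 (y x : vec) (t : R) : on_S2 y -> on_S2 x -> 0 < t < 1 / 4 ->
  0 < dot (ray y x t) (ray y x t).
Proof.
  intros Hy Hx Ht; rewrite dot_ray_self by auto; pose proof (dot_S2_le y x Hy Hx).
  assert (t * (1 - t) <= 3 / 16) by nra.
  assert (0 <= t * (1 - t)) by nra.
  replace (2 * t * (1 - t) * (1 - dot y x)) with (2 * (t * (1 - t)) * (1 - dot y x)) by ring.
  set (X := t * (1 - t)) in *; nra.
Qed.

(** The derivative at [t = 0] of [dot (unit (ray y x t)) a] is [dot x a - dot y a * dot y x],
    nonnegative at a minimizer. Only arcs issuing from [y] towards [x] enter, so the lemma serves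
    both [D] and its polar. *)
Lemma argmin_first_order (A : vec -> Prop) (a y x : vec) :
  on_S2 y -> on_S2 x ->
  (forall t, 0 < t < 1 / 4 -> A (unit (ray y x t))) ->
  (forall z, A z -> dot y a <= dot z a) ->
  dot y a * dot y x <= dot x a.
Proof.
  intros Hy Hx Harc Hmin.
  apply le_of_all_small with (4 * Rabs (dot y a)); intros e He.
  set (t := e / 5); assert (Ht : 0 < t < 1 / 4) by (unfold t; lra).
  set (al := dot y a) in *; set (g := dot y x).
  pose proof (dot_S2_le y x Hy Hx) as Hg; fold g in Hg.
  pose proof (dot_ray_self y x t Hy Hx) as En; fold g in En.
  pose proof (dot_ray_gt0 y x t Hy Hx Ht) as Hpos.
  pose proof (dot_unit _ a Hpos) as Eu; pose proof (Hmin _ (Harc t Ht)) as Hle.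
  rewrite dot_ray in Eu; fold al in Eu.
  pose proof (vnorm_sqr (ray y x t)) as Er; pose proof (vnorm_gt0 _ Hpos) as Hr.
  set (r := vnorm (ray y x t)) in *; rewrite En in Er.
  (* The linearization of the norm [r] at [t = 0]; [r] exceeds it by at most [t * t], an error that
     vanishes after division by [t]. *)
  set (B := 1 - t * (1 - g)).
  assert (HB : 1 / 2 <= B) by (unfold B; nra).
  assert (ErB : r * r = B * B + t * t * (1 - g * g)) by (rewrite Er; unfold B; ring).
  assert (Hg2 : 0 <= 1 - g * g <= 1) by nra.
  assert (0 <= t * t) by nra.
  assert (B <= r) by nra.
  assert (r <= B + t * t) by nra.
  assert (Hr2 : - (Rabs al * (t * t)) <= al * (r - B)).
  { pose proof (Rle_abs al); pose proof (Rle_abs (- al)) as Hn; rewrite Rabs_Ropp in Hn.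
    pose proof (Rabs_pos al); nra. }
  assert (Hfin : al * r <= (1 - t) * al + t * dot x a) by nra.
  assert (t * (al * g) <= t * (dot x a + Rabs al * t)) by (unfold B in *; nra).
  assert (al * g <= dot x a + Rabs al * t) by (apply Rmult_le_reg_l with t; lra).
  pose proof (Rabs_pos al); unfold t in *; nra.
Qed.

Lemma convex_ray (D : vec -> Prop) (y x : vec) (t : R) :
  convex D -> D y -> D x -> 0 <= t <= 1 -> D (unit (ray y x t)).
Proof.
  intros (_ & _ & Harc) Hy Hx Ht; apply (Harc y x); auto; exists t; split; auto.
  unfold unit; replace (ray y x t) with (vadd (vscale (1 - t) y) (vscale t x)); auto.
  apply vec_eq; simpl; ring.
Qed.

Lemma convex_argmin_first_order (D : vec -> Prop) (a y x : vec) :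
  convex D -> D y -> D x -> (forall z, D z -> dot y a <= dot z a) ->
  dot y a * dot y x <= dot x a.
Proof.
  intros HD Hy Hx Hmin; apply argmin_first_order with D; auto; try (apply HD; auto).
  intros t Ht; apply convex_ray; auto; lra.
Qed.

(** Let [y] be the point of [D] nearest to [z]. If [dot y z <= 0], the hemisphere opposite to [z]
    works. Otherwise [dot y z * y - z] is normal to the great circle through [y] orthogonal to the
    arc [y z], and the first-order condition at [y] puts [D] on its positive side. *)
Lemma convex_separation (D : vec -> Prop) (z : vec) :
  convex D -> closed_S2 D -> (exists x, D x) -> on_S2 z -> ~ D z ->
  exists h, polar D h /\ dot z h < 0.
Proof.
  intros HD Hcl Hne Hz HN; assert (HS : forall x, D x -> on_S2 x) by apply HD.
  assert (HzN : on_S2 (vopp z)) by (unfold on_S2 in *; dots; lra).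
  destruct (closed_S2_argmin D (vopp z)) as (y & HDy & Hmin); auto.
  set (m := dot y z).
  destruct (Rle_dec m 0) as [Hm|Hm].
  - exists (vopp z); split; [split; auto|].
    + intros x HDx; specialize (Hmin x HDx); dots; unfold m in Hm; lra.
    + dots; rewrite Hz; lra.
  - set (w := vadd (vscale m y) (vopp z)).
    pose proof (dot_S2_le y z (HS y HDy) Hz) as B; fold m in B.
    assert (Hm1 : m <> 1).
    { intros E; apply HN; rewrite <- (dot_S2_eq1 y z); auto. }
    assert (Hm2 : m < 1) by lra.
    assert (Hw : 0 < dot w w).
    { unfold w; dots; rewrite (dot_comm z y), (HS y HDy), Hz; fold m; nra. }
    pose proof (vnorm_gt0 w Hw).
    exists (unit w); split; [split; [now apply unit_S2|]|].
    + intros x HDx.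
      pose proof (convex_argmin_first_order D (vopp z) y x HD HDy HDx Hmin) as Hf.
      pose proof (dot_unit w x Hw) as E; rewrite (dot_comm x).
      assert (0 <= dot w x); [|nra].
      unfold w; dots; fold m in Hf; rewrite (dot_comm z x); lra.
    + pose proof (dot_unit w z Hw) as E; rewrite (dot_comm z).
      assert (dot w z < 0); [|nra].
      unfold w; dots; rewrite Hz; fold m; nra.
Qed.

Lemma bipolar (D : vec -> Prop) (z : vec) :
  convex D -> closed_S2 D -> (exists x, D x) -> on_S2 z ->
  (forall h, polar D h -> 0 <= dot z h) -> D z.
Proof.
  intros HD Hcl Hne Hz H; apply NNPP; intros HN.
  destruct (convex_separation D z) as (h & Hh & Hlt); auto.
  specialize (H h Hh); lra.
Qed.

(** * Minimizing over the polar, and supporting hemispheres *)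

Lemma polar_closed (D : vec -> Prop) : (forall x, D x -> on_S2 x) -> closed_S2 (polar D).
Proof.
  intros HD k Hk HN.
  destruct (classic (exists x, D x /\ dot x k < 0)) as [(x & HDx & Hx)|HN'].
  - exists (- dot x k); split; [lra|]; intros y Hy Hd [_ Hpos].
    specialize (Hpos x HDx); rewrite dot_comm in Hpos.
    pose proof (dot_edist_le y k x (HD x HDx)) as B.
    replace (edist y k) with (edist k y) in B.
    + rewrite (dot_comm k x) in B; lra.
    + unfold edist, vnorm; f_equal; unfold dot; simpl; ring.
  - destruct HN; split; auto; intros x HDx.
    destruct (Rle_dec 0 (dot x k)); auto; destruct HN'; exists x; split; auto; lra.
Qed.

Lemma polar_argmin_first_order (D : vec -> Prop) (k h h' : vec) :
  (forall x, D x -> on_S2 x) -> polar D h -> polar D h' ->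
  (forall z, polar D z -> dot h k <= dot z k) ->
  dot h k * dot h h' <= dot h' k.
Proof.
  intros HD Hh Hh' Hmin; apply argmin_first_order with (polar D); auto.
  - apply Hh.
  - apply Hh'.
  - intros t Ht.
    assert (Hp : 0 < dot (ray h h' t) (ray h h' t)).
    { apply dot_ray_gt0; auto; [apply Hh | apply Hh']. }
    (* The arc from [h] to [h'] stays in the polar since its vectors are positive multiples of
       convex combinations of [h] and [h']. *)
    pose proof (vnorm_gt0 _ Hp).
    split; [now apply unit_S2|]; intros x HDx; rewrite dot_comm.
    pose proof (dot_unit _ x Hp) as E; rewrite dot_ray, (dot_comm h), (dot_comm h') in E.
    pose proof (proj2 Hh x HDx); pose proof (proj2 Hh' x HDx).
    assert (0 <= (1 - t) * dot x h + t * dot x h') by nra; nra.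
Qed.

(** Choose [k] in the polar with [dot k p] minimal. Were this minimum positive, all points of the
    sphere closer than it to [p] would satisfy every polar inequality and lie in [D] by the bipolar
    theorem, making [p] interior. *)
Lemma boundary_support (D : vec -> Prop) (p : vec) :
  convex D -> closed_S2 D -> boundary_pt D p -> exists k, polar D k /\ dot p k = 0.
Proof.
  intros HD Hcl (Hp & HDp & Hbd); assert (HS : forall x, D x -> on_S2 x) by apply HD.
  destruct (closed_S2_argmin (polar D) p) as (k & Hk & Hmin).
  - intros k [Hk _]; auto.
  - now apply polar_closed.
  (* The polar is nonempty: [D] contains [p], hence not its antipode, which can be separated from
     [D]. *)
  - destruct (convex_separation D (vopp p)) as (h & Hh & _); eauto.
    + unfold on_S2 in *; dots; lra.
    + intros HN; apply (proj1 (proj2 HD) p (vopp p)); auto; reflexivity.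
  - exists k; split; auto; rewrite dot_comm.
    pose proof (proj2 Hk p HDp) as H0; rewrite dot_comm in H0.
    destruct (Req_dec (dot k p) 0) as [|Hne]; auto; exfalso.
    destruct (Hbd (dot k p)) as (y & Hy & Hd & HN); [lra|].
    apply HN, bipolar; eauto; intros h Hh.
    specialize (Hmin h Hh); rewrite (dot_comm h p) in Hmin.
    pose proof (dot_edist_le p y h (proj1 Hh)); lra.
Qed.

(** A small push of [p] away from the pole [k] leaves the hemisphere, hence [D]. *)
Lemma support_boundary (D : vec -> Prop) (p k : vec) :
  (forall x, D x -> on_S2 x) -> polar D k -> D p -> dot p k = 0 -> boundary_pt D p.
Proof.
  intros HD [Hk Hpos] HDp Hpk; split; [|split]; auto; intros eps Heps.
  set (e := Rmin (1 / 2) (eps / 4)).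
  assert (He : 0 < e) by (apply Rmin_pos; lra).
  assert (e <= 1 / 2) by apply Rmin_l; assert (e <= eps / 4) by apply Rmin_r.
  destruct (on_S2_shift p k e) as [_ Hw]; auto; [lra|].
  exists (unit (vadd p (vscale (- e) k))); split; [now apply unit_S2|split].
  - pose proof (edist_unit p _ (HD p HDp) Hw) as B.
    rewrite edist_shift, (vnorm_S2 k Hk), Rabs_Ropp, Rabs_pos_eq in B; lra.
  - intros HN; specialize (Hpos _ HN); pose proof (dot_unit _ k Hw) as E.
    pose proof (vnorm_gt0 _ Hw).
    revert E; rewrite dot_vadd_l, dot_vscale_l, Hpk, Hk; intros E; nra.
Qed.

Lemma farthest_support (D : vec -> Prop) (x y : vec) :
  convex D -> D x -> D y -> (forall z, D z -> dot y x <= dot z x) -> dot y x < 1 ->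
  polar D (vscale (/ sqrt (1 - dot y x * dot y x)) (vadd x (vscale (- dot y x) y))).
Proof.
  intros HD HDx HDy Hmin Hlt; assert (HS : forall x, D x -> on_S2 x) by apply HD.
  set (g := dot y x) in *.
  pose proof (dot_S2_le y x (HS y HDy) (HS x HDx)) as B; fold g in B.
  assert (g <> -1).
  { intros E; apply (proj1 (proj2 HD) y x); auto; apply dot_S2_eqN1; auto. }
  assert (Hs : 0 < sqrt (1 - g * g)) by (apply sqrt_lt_R0; nra).
  assert (Hss : sqrt (1 - g * g) * sqrt (1 - g * g) = 1 - g * g) by (apply sqrt_sqrt; nra).
  split.
  - unfold on_S2; dots; rewrite (dot_comm x y), (HS x HDx), (HS y HDy); fold g.
    transitivity ((1 - g * g) / (sqrt (1 - g * g) * sqrt (1 - g * g))); [field; lra|].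
    rewrite Hss; field; nra.
  - intros z HDz; dots; apply Rmult_le_pos; [apply Rlt_le, Rinv_0_lt_compat; auto|].
    pose proof (convex_argmin_first_order D x y z HD HDy HDz Hmin) as Hf.
    fold g in Hf; rewrite (dot_comm z y); lra.
Qed.

(** * From constant width to constant diameter *)

Definition polar_width (D : vec -> Prop) (c : R) : Prop :=
  forall k p, polar D k -> D p -> dot p k = 0 ->
    (exists h, polar D h /\ dot k h = - c) /\ (forall h, polar D h -> - c <= dot k h).

Lemma polar_width_diameter (D : vec -> Prop) (c : R) (x y : vec) :
  convex D -> closed_S2 D -> 0 < c < 1 -> polar_width D c -> D x -> D y -> c <= dot y x.
Proof.
  intros HD Hcl Hc HW HDx HDy'; assert (HS : forall x, D x -> on_S2 x) by apply HD.
  destruct (closed_S2_argmin D x HS Hcl ltac:(eauto)) as (z & HDz & Hmin).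
  apply Rle_trans with (dot z x); auto; clear y HDy'; rename z into y, HDz into HDy.
  set (g := dot y x) in *; destruct (Rle_dec c g) as [|HN]; auto; exfalso.
  pose proof (farthest_support D x y HD HDx HDy Hmin ltac:(fold g; lra)) as Hk.
  fold g in Hk; set (s := sqrt (1 - g * g)) in *.
  pose proof (dot_S2_le y x (HS y HDy) (HS x HDx)) as B; fold g in B.
  assert (g <> -1).
  { intros E; apply (proj1 (proj2 HD) y x); auto; apply dot_S2_eqN1; auto. }
  assert (Hs : 0 < s) by (apply sqrt_lt_R0; nra).
  assert (Hss : s * s = 1 - g * g) by (apply sqrt_sqrt; nra).
  set (k := vscale (/ s) (vadd x (vscale (- g) y))) in *.
  assert (Hky : dot y k = 0).
  { unfold k; dots; rewrite (HS y HDy); fold g; ring. }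
  destruct (HW k y Hk HDy Hky) as [(h & Hh & E) _].
  (* Since [x = g * y + s * k], membership of [x] in [h] reads [g * a >= s * c] with [a = dot y h].
     For [g < 0] this contradicts [a >= 0]; for [0 <= g < c] Bessel gives [a < s], whence
     [g * a < s * c]. *)
  assert (Ex : s * dot k h = dot x h - g * dot y h) by (unfold k; dots; field; lra).
  pose proof (bessel2 y k h (HS y HDy) (proj1 Hk) Hky (proj1 Hh)) as Hb.
  rewrite (dot_comm h y), (dot_comm h k), E in Hb; rewrite E in Ex.
  pose proof (proj2 Hh x HDx); pose proof (proj2 Hh y HDy).
  set (a := dot y h) in *.
  destruct (Rle_dec 0 g) as [Hg|Hg]; [|nra].
  assert (g * g < c * c) by nra.
  assert (a < s) by nra; nra.
Qed.

(** The point is the midpoint of the semicircle of the lune on the boundary of [h]. Minimality of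
    [h] gives [- c * dot h h' <= dot h' k], which says that this point lies in every [h'] of the
    polar; the bipolar theorem concludes. *)
Lemma polar_width_touching (D : vec -> Prop) (c : R) (k h : vec) :
  convex D -> closed_S2 D -> (exists x, D x) -> 0 < c < 1 -> polar D k -> polar D h ->
  dot h k = - c -> (forall h', polar D h' -> - c <= dot h' k) ->
  D (vscale (/ sqrt (1 - c * c)) (vadd k (vscale c h))).
Proof.
  intros HD Hcl Hne Hc Hk Hh E Hmin.
  assert (Hs : 0 < sqrt (1 - c * c)) by (apply sqrt_lt_R0; nra).
  assert (Hss : sqrt (1 - c * c) * sqrt (1 - c * c) = 1 - c * c) by (apply sqrt_sqrt; nra).
  apply bipolar; auto.
  - unfold on_S2; dots; rewrite (dot_comm k h), (proj1 Hk), (proj1 Hh), E.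
    transitivity ((1 - c * c) / (sqrt (1 - c * c) * sqrt (1 - c * c))); [field; lra|].
    rewrite Hss; field; nra.
  - intros h' Hh'; dots; apply Rmult_le_pos; [apply Rlt_le, Rinv_0_lt_compat; auto|].
    assert (Hf : dot h k * dot h h' <= dot h' k).
    { apply polar_argmin_first_order with D; auto; [apply HD|].
      intros z Hz; rewrite E; auto. }
    rewrite E in Hf; rewrite (dot_comm k h'); lra.
Qed.

Lemma polar_width_partner (D : vec -> Prop) (c : R) (p k : vec) :
  convex D -> closed_S2 D -> 0 < c < 1 -> polar_width D c ->
  polar D k -> D p -> dot p k = 0 -> exists y, boundary_pt D y /\ dot p y = c.
Proof.
  intros HD Hcl Hc HW Hk HDp Hpk; assert (HS : forall x, D x -> on_S2 x) by apply HD.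
  destruct (HW k p Hk HDp Hpk) as [(h & Hh & E) Hmin].
  set (s := sqrt (1 - c * c)).
  assert (Hs : 0 < s) by (apply sqrt_lt_R0; nra).
  assert (Hss : s * s = 1 - c * c) by (apply sqrt_sqrt; nra).
  set (y := vscale (/ s) (vadd k (vscale c h))).
  set (z := vscale (/ s) (vadd h (vscale c k))).
  pose proof (proj1 Hk) as Hk1; pose proof (proj1 Hh) as Hh1; unfold on_S2 in Hk1, Hh1.
  assert (HDy : D y).
  { apply polar_width_touching; eauto; [rewrite dot_comm; auto|].
    intros h' Hh'; rewrite dot_comm; auto. }
  assert (Hyh : dot y h = 0) by (unfold y; dots; rewrite E, Hh1; ring).
  (* The hemisphere [h] supports [D] at [y], so the width condition applies to [h] as well and makes
     [k] a minimizer for it. *)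
  assert (HDz : D z).
  { destruct (HW h y Hh HDy Hyh) as [_ Hmin'].
    apply polar_width_touching; eauto; intros h' Hh'; rewrite dot_comm; auto. }
  (* Uses [dot p k = 0]. Then [dot y p = c * dot z p <= c], and the diameter bound forces
     equality. *)
  assert (Hyz : s * dot y p = c * (s * dot z p)).
  { transitivity (dot k p + c * dot h p); [unfold y; dots; field; lra|].
    transitivity (c * (dot h p + c * dot k p)); [|unfold z; dots; field; lra].
    rewrite (dot_comm k p), Hpk; ring. }
  exists y; split; [apply support_boundary with h; auto|].
  pose proof (polar_width_diameter D c y p HD Hcl Hc HW HDy HDp) as Hlow.
  pose proof (dot_S2_le z p (HS z HDz) (HS p HDp)).
  assert (dot y p = c * dot z p) by nra.
  rewrite dot_comm in Hlow |- *; nra.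
Qed.

(** * Constant width on the polar, and the equivalence *)

Lemma constant_width_polar (D : vec -> Prop) (w : R) :
  convex_body D -> 0 < w < PI -> (constant_width D w <-> polar_width D (cos w)).
Proof.
  intros (HD & Hcl & q & HDq & Hq) Hw; assert (HS : forall x, D x -> on_S2 x) by apply HD.
  assert (Hopp : forall k, polar D k -> ~ polar D (vopp k)).
  { intros k Hk; apply polar_vopp with q; auto. }
  split.
  - intros HW k p Hk HDp Hpk; apply width_is_polar; auto.
    apply HW; exists p; split; [apply Hk|split; [|split; [split|]]]; auto.
    apply polar_subset_hemi; auto.
  - intros HW k (p & Hk & Hsub & [_ Hpk] & HDp).
    assert (polar D k) by (apply polar_subset_hemi; auto).
    apply width_is_polar; eauto.
Qed.

Lemma exists_orthogonal (q : vec) : on_S2 q -> exists z, on_S2 z /\ dot q z = 0.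
Proof.
  intros Hq; set (w := V (vy q) (- vx q) 0); destruct (Req_dec (dot w w) 0) as [E|E].
  - exists (V 1 0 0); unfold on_S2, dot, w in *; simpl in *; split; nra.
  - assert (Hw : 0 < dot w w) by (pose proof (dot_self_ge0 w); lra).
    exists (unit w); split; [now apply unit_S2|].
    pose proof (dot_unit w q Hw) as Eq; pose proof (vnorm_gt0 w Hw); rewrite dot_comm.
    assert (dot w q = 0) by (unfold w, dot; simpl; ring); nra.
Qed.

Theorem theorem2 (delta : R) (D : vec -> Prop) :
  0 < delta < PI / 2 -> convex_body D ->
  (constant_diameter D delta <-> constant_width D delta).
Proof.
  intros Hd Hbody; rewrite (constant_width_polar D delta) by (auto; lra).
  assert (Hc : 0 < cos delta < 1).
  { split; [apply cos_gt_0; lra|]; rewrite <- cos_0; apply cos_decreasing_1; lra. }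
  pose proof Hbody as (HD & Hcl & q & HDq & Hq).
  assert (HS : forall x, D x -> on_S2 x) by apply HD.
  split.
  - intros (_ & [Hub _] & Hpart) k p Hk HDp Hpk.
    assert (Hdiam : forall x y, D x -> D y -> cos delta <= dot x y).
    { intros x y Hx Hy; apply sdist_le_iff; auto; [lra|]; apply Hub; eauto. }
    assert (Hcomp : forall z, on_S2 z -> (forall x, D x -> cos delta <= dot z x) -> D z).
    { intros z Hz; apply constant_diameter_complete with q; auto; [lra|].
      intros b Hb; destruct (Hpart b Hb) as (b' & Hb' & E).
      exists b'; split; [apply Hb'|].
      apply sdist_eq_iff in E; auto; [apply Hb | apply Hb' | lra]. }
    apply support_width with p; auto.
    apply Hcomp; [|intros x Hx; apply complete_support_ball with D; auto].
    pose proof (proj1 Hk) as Hk1; pose proof (HS p HDp) as Hp1; unfold on_S2 in *.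
    unfold opposite; dots; rewrite (dot_comm k p), Hp1, Hk1, Hpk.
    assert (sqrt (1 - cos delta * cos delta) * sqrt (1 - cos delta * cos delta)
            = 1 - cos delta * cos delta) by (apply sqrt_sqrt; nra).
    lra.
  - intros HW.
    assert (Hpartner : forall p, boundary_pt D p ->
              exists p', boundary_pt D p' /\ sdist p p' = delta).
    { intros p Hp; destruct (boundary_support D p) as (k & Hk & Hpk); auto.
      destruct (polar_width_partner D (cos delta) p k) as (y & Hy & E); auto.
      - apply Hp.
      - exists y; split; auto; apply sdist_eq_iff; auto; [apply Hp | apply Hy | lra]. }
    split; [auto|split; [|auto]]; split.
    + intros r (x & y & Hx & Hy & ->); apply sdist_le_iff; auto; [lra|].
      apply polar_width_diameter with D; auto.
    + intros b Hb.
      (* To see that [delta] is attained, a boundary point is needed: of two antipodal points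
         orthogonal to [q] one is outside [D], and the arc from [q] to it crosses the boundary. *)
      destruct (exists_orthogonal q) as (z & Hz & Hqz); auto.
      assert (HzN : exists z', on_S2 z' /\ dot q z' = 0 /\ ~ D z').
      { destruct (classic (D z)) as [HDz|HDz]; [|exists z; auto].
        exists (vopp z); split; [unfold on_S2 in *; dots; lra|split; [dots; lra|]].
        intros HN; apply (proj1 (proj2 HD) z (vopp z)); auto; reflexivity. }
      destruct HzN as (z' & Hz' & Hqz' & HDz').
      destruct (boundary_crossing D q z') as (t & _ & Ht); auto; [lra|].
      destruct (Hpartner _ Ht) as (p' & Hp' & <-).
      apply Hb; exists (unit (ray q z' t)), p'; split; [apply Ht|split; [apply Hp'|auto]].
Qed.
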